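(* For every integer $k\ge 0$, the tuple $(2^0+1, 2^1+1, 2^2+1,\dots,2^k+1)=(2,3,5,\dots,2^k+1)$ is bad.
   Context: A tuple $(a_1,\dots,a_k)$ of positive integers is good if there are sets $S_1,\dots,S_k\subseteq\mathbb{R}$ such that any two distinct elements of $S_i$ differ by at least $a_i$ and every integer belongs to $S_1\cup\dots\cup S_k$; otherwise it is bad. *)

(* Defs.v *)
From mathcomp Require Import all_boot all_order all_algebra.
From mathcomp Require Import all_classical all_reals.

Set Implicit Arguments.
Unset Strict Implicit.
Unset Printing Implicit Defensive.

Import Order.TTheory GRing.Theory Num.Theory.
Local Open Scope classical_set_scope.
Local Open Scope ring_scope.

(* Only meant for tuples all of whose entries are positive. *)
Definition good (R : realType) (k : nat) (a : k.-tuple nat) : Prop :=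
  exists S : 'I_k -> set R,
    (forall (i : 'I_k) (x y : R),
        S i x -> S i y -> x <> y -> (tnth a i)%:R <= `|x - y|) /\
    (forall n : int, (\bigcup_(i in [set: 'I_k]) S i) n%:~R).

Definition bad (R : realType) (k : nat) (a : k.-tuple nat) : Prop :=
  ~ good R a.

(* Main.v *)
Require Import Defs.
From mathcomp Require Import all_boot all_order all_algebra.
From mathcomp Require Import all_classical all_reals.
From mathcomp Require Import zify.

(** Any [2 ^ n] consecutive integers contain one missed by [S_0, ..., S_(n-1)],
    by induction on [n]. Split [2 ^ n.+1] consecutive integers into two halves
    and take a point of each half missed by [S_0, ..., S_(n-1)]. If [S_n]
    contains both points [x < y], they are more than [2 ^ n] apart; one of the
    [2 ^ n] integers following [x] is missed by [S_0, ..., S_(n-1)], and it is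
    too close to [x] to lie in [S_n]. *)

Import Order.TTheory GRing.Theory Num.Theory.
Local Open Scope ring_scope.

Lemma separated_sets_miss_point (S : nat -> set int) (n : nat) (m : int) :
  (forall i x y, (i < n)%N -> S i x -> S i y -> x < y ->
     x + (2 ^ i + 1)%N%:Z <= y) ->
  exists2 x : int, m <= x < m + (2 ^ n)%N%:Z & forall i, (i < n)%N -> ~ S i x.
Proof.
elim: n m => [|n IHn] m sepS; first by exists m => //; rewrite expn0; lia.
have {}IHn m' : exists2 x : int, m' <= x < m' + (2 ^ n)%N%:Z &
    forall i, (i < n)%N -> ~ S i x.
  by apply: IHn => i x y ltin; apply: sepS; apply: ltnW.
have missS x : (forall i, (i < n)%N -> ~ S i x) -> ~ S n x ->
    forall i, (i < n.+1)%N -> ~ S i x.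
  by move=> missx nSx i; rewrite ltnS leq_eqVlt => /predU1P[->|/missx].
have [x xI missx] := IHn m.
have [y yI missy] := IHn (m + (2 ^ n)%N%:Z).
rewrite expnS.
have [Sx|nSx] := pselect (S n x); last by exists x; [lia|exact: missS].
have [Sy|nSy] := pselect (S n y); last by exists y; [lia|exact: missS].
have xy : x + (2 ^ n + 1)%N%:Z <= y by apply: (sepS n) => //; lia.
have [z zI missz] := IHn (x + 1).
(* The block of [2 ^ n.+1] integers contains [z] because [z <= x + 2 ^ n < y] by [xy], and [y] is in
   the block. *)
exists z; first lia.
apply: missS => // Sz.
have : x + (2 ^ n + 1)%N%:Z <= z by apply: (sepS n) => //; lia.
lia.
Qed.

Theorem theorem8 (R : realType) (k : nat) :
  bad R [tuple (2 ^ i + 1)%N | i < k.+1].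
Proof.
move=> [S [sepS covS]].
(* The integer trace of each real set. [inord] is faithful for [i < k.+1], the only indices that the
   lemma constrains. *)
pose T (i : nat) (x : int) := S (inord i) x%:~R.
have [i x y ltik Tx Ty ltxy|x _ missx] := @separated_sets_miss_point T k.+1 0.
  have neq : y%:~R <> x%:~R :> R by move/intr_inj; lia.
  (* With [y] first, the difference is positive and the absolute value drops. *)
  have := sepS _ _ _ Ty Tx neq.
  rewrite tnth_mktuple inordK // -intrB ger0_norm ?ler0z; last by lia.
  rewrite pmulrn ler_int; lia.
have [i _ Six] := covS x.
by apply: (missx i (ltn_ord i)); rewrite /T inord_val.
Qed.
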